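(* Let ${\bf a},{\bf b}\in(2\mathbb N)^p$ and ${\bf c},{\bf d}\in(2\mathbb N)^q$, and let $n\ge\max(2,p+q)$ be an integer. Then $$\Phi_n\begin{pmatrix}{\bf a}&{\bf c}\\ {\bf b}&{\bf d}\end{pmatrix}=\Phi_n\begin{pmatrix}{\bf a}&{\bf d}\\ {\bf b}&{\bf c}\end{pmatrix}.$$
   Context: Double factorial convention: for an integer $m\ge0$, $m!!=(m-1)(m-3)\cdots$, the product of the positive integers $\le m-1$ of the parity of $m-1$ (empty product $=1$). For a $2\times q$ matrix with nonnegative integer entries and $n\ge\max(2,q)$, $I_n\begin{pmatrix}{\bf a}\\{\bf b}\end{pmatrix}=\int_{O_n}\prod_j u_{1j}^{a_j}u_{2j}^{b_j}\,du$ (Haar probability measure on $O_n$) and $\Phi_n\begin{pmatrix}{\bf a}\\ {\bf b}\end{pmatrix}=\frac{(\Sigma a_i+n-2)!!\,(\Sigma b_i+n-2)!!}{(n-2)!!^2\,\prod a_i!!\,\prod b_i!!}\,I_n\begin{pmatrix}{\bf a}\\ {\bf b}\end{pmatrix}$. *)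

(* Defs.v *)
From HB Require Import structures.
From mathcomp Require Import all_boot all_order all_algebra.
From mathcomp Require Import all_classical all_reals all_analysis.
Set Implicit Arguments. Unset Strict Implicit. Unset Printing Implicit Defensive.
Import Order.TTheory GRing.Theory Num.Theory.
Import numFieldNormedType.Exports.
Local Open Scope classical_set_scope.
Local Open Scope ring_scope.

Fixpoint sdfact (k : nat) : nat :=
  match k with
  | 0 => 1
  | 1 => 1
  | (k'.+2) as k2 => (k2 * sdfact k')%N
  end.

(* The paper's convention: m!! = (m-1)(m-3)..., product of positive integers
   <= m-1 with the parity of m-1 (empty product = 1). *)
Definition dfact (m : nat) : nat :=
  match m with 0 => 1%N | m'.+1 => sdfact m' end.

Definition MatSpace (R : realType) (n : nat) :=
  g_sigma_algebraType (@open 'M[R]_n).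

Definition orthogonal_mx (R : realType) (n : nat) (u : 'M[R]_n) : Prop :=
  u *m u^T = 1%:M.

Definition is_Haar_On (R : realType) (n : nat)
    (mu : probability (MatSpace R n) R) : Prop :=
  mu [set u : MatSpace R n | orthogonal_mx u] = 1%E /\
  (forall U : 'M[R]_n, orthogonal_mx U ->
     forall A : set (MatSpace R n), measurable A ->
       mu ((fun u : MatSpace R n => U *m u) @^-1` A) = mu A).

(* entry (i, j) of u, indices as natural numbers (0-based); 0 if out of range *)
Definition ent (R : realType) (n : nat) (u : 'M[R]_n) (i j : nat) : R :=
  match @insub _ (fun k => k < n)%N _ i, @insub _ (fun k => k < n)%N _ j with
  | Some i', Some j' => u i' j'
  | _, _ => 0
  end.

(* I_n (a ; b) = \int_{O_n} prod_j u_{1j}^{a_j} u_{2j}^{b_j} du, for the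
   2 x k matrix with rows a, b (size a = size b = k). Rows 1,2 and columns
   1..k of the paper are indices 0,1 and 0..k-1 here. *)
Definition In_int (R : realType) (n : nat) (mu : probability (MatSpace R n) R)
    (a b : seq nat) : R :=
  Rintegral mu setT (fun u : MatSpace R n =>
    \prod_(j < size a) (ent u 0 j ^+ nth 0%N a j * ent u 1 j ^+ nth 0%N b j)).

Definition Phi (R : realType) (n : nat) (mu : probability (MatSpace R n) R)
    (a b : seq nat) : R :=
  ((dfact (sumn a + n - 2))%:R * (dfact (sumn b + n - 2))%:R)
  / ((dfact (n - 2))%:R ^+ 2 * (\prod_(x <- a) dfact x)%:R
       * (\prod_(x <- b) dfact x)%:R)
  * In_int mu a b.

(* Main.v *)
Require Import Defs.
From HB Require Import structures.
From mathcomp Require Import all_boot all_order all_algebra.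
From mathcomp Require Import all_classical all_reals all_analysis.
From mathcomp Require Import measurable_realfun ring.
Import Order.TTheory GRing.Theory Num.Theory.
Import numFieldNormedType.Exports.
Set Implicit Arguments. Unset Strict Implicit. Unset Printing Implicit Defensive.
Local Open Scope ring_scope.

(** Let [x], [y] be the first two rows of a Haar orthogonal matrix. Reflections
    mixing row [k] with row [l], together with [u^T u = 1], give
    integration-by-parts recursions for the moments [E x^a y^b]. Their solution
    is, up to a factor depending only on [|b|],
      [E x^a y^b = L_{|a|} (\prod_j h_{a_j, b_j})],
    where [h_{a, b}(s) = E (X^a Y^b)] for a centered Gaussian pair with
    [E X^2 = 1], [E XY = s], [E Y^2 = 1 + s^2], and [L_A] is a linear functional
    on polynomials in [s]. Formally [y_j = G_j + s X_j] with [s] an imaginary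
    Gaussian variable: projecting a Gaussian vector onto the orthogonal of [x]
    changes its covariance from [I] to [I - x x^T].

    Rescaling [X] shows [(1 + s^2)^(a/2) h_{a, b} = (1 + s^2)^(b/2) h_{b, a}],
    and the normalization of [Phi_n] is exactly what turns multiplication by
    [1 + s^2] into the shift [A -> A + 2] of the normalized [L_A]. Hence [Phi_n]
    is unchanged when the two entries of any single column are exchanged. *)

(** * Gaussian polynomials and the radial functional *)

Lemma deriv_prod (R : comNzRingType) (I : finType) (F : I -> {poly R}) :
  (\prod_i F i)^`() = \sum_m (F m)^`() * \prod_(i | i != m) F i.
Proof.
have H (s : seq I) : uniq s -> (\prod_(i <- s) F i)^`() =
   \sum_(m <- s) (F m)^`() * \prod_(i <- s | i != m) F i.
  elim: s => [|x s IH] /=; first by rewrite !big_nil derivC.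
  case/andP=> xs us; rewrite !big_cons derivM IH // eqxx.
  congr (_ * _ + _).
    rewrite [RHS]big_seq_cond [LHS]big_seq; apply: eq_bigl => i.
    by case: (boolP (i \in s)) => //= si; case: eqP => // e; rewrite -e si in xs.
  rewrite mulr_sumr [LHS]big_seq [RHS]big_seq; apply: eq_bigr => m ms.
  rewrite big_cons ifT; first by rewrite mulrCA.
  by apply/eqP=> e; rewrite e ms in xs.
exact/H/index_enum_uniq.
Qed.

Section Gauss.
Variable R : realFieldType.

(** Moments of a standard Gaussian; the factor [k' = 0] kills the first moment, whatever [0.-1]
    returns. *)
Fixpoint gmom (k : nat) : R :=
  if k is k'.+1 then k'%:R * gmom k'.-1 else 1.

(* [hpoly b a] is the polynomial h_{a, b} of the introduction: a Gaussian
   integration by parts in Y lowers b, which therefore comes first. *)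
Fixpoint hpoly (b a : nat) : {poly R} :=
  if b is b'.+1 then b'%:R *: hpoly b'.-1 a + 'X * hpoly b' a.+1
  else (gmom a)%:P.

Lemma hpolyS b a : hpoly b.+1 a = b%:R *: hpoly b.-1 a + 'X * hpoly b a.+1.
Proof. by []. Qed.

(** Since Y = G + s X, differentiating in s trades one factor Y for a factor X. *)
Lemma deriv_hpoly b a : (hpoly b a)^`() = b%:R *: hpoly b.-1 a.+1.
Proof.
elim/ltn_ind: b a => -[|b] IH a; first by rewrite derivC scale0r.
rewrite hpolyS derivD derivZ derivM derivX mul1r !IH //; last by case: b {IH}.
case: b {IH} => [|b]; rewrite ?hpolyS -!mul_polyC !rmorph_nat /=; ring.
Qed.

(** Gaussian integration by parts in X, with E X^2 = 1 and E XY = s. *)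
Lemma hpolySr b a :
  hpoly b a.+1 = a%:R *: hpoly b a.-1 + b%:R *: ('X * hpoly b.-1 a).
Proof.
elim/ltn_ind: b a => -[|b] IH a.
  by rewrite scale0r addr0 /= polyCM -mul_polyC.
rewrite hpolyS (IH b) // {1}(IH b.-1) //; last by case: b {IH}.
case: a => [|a]; case: b {IH} => [|b];
  rewrite /= ?hpolyS /= ?hpolyS -!mul_polyC !rmorph_nat /=; ring.
Qed.

(** Y and sqrt(1 + s^2) X have the same variance, so they are exchangeable. The proof derives this
    from the recursions by algebra alone. *)
Lemma hpoly_swap k a :
  hpoly (a + k.*2) a = (1 + 'X^2) ^+ k * hpoly a (a + k.*2).
Proof.
elim: a k => [|a IHa] k; elim: k => [|k IHk];
  rewrite ?doubleS ?addn0 ?expr0 ?mul1r // !addnS.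
  move: IHk; rewrite add0n => IHk.
  rewrite hpolyS hpolySr /= IHk [_ ^+ k.+1]exprS /= !polyCM -!mul_polyC.
  rewrite !rmorph_nat; move: (_ ^+ k) => W; ring.
move: (IHa k.+1) IHk; rewrite doubleS !addnS !addSn => IHa' IHk.
rewrite hpolyS [hpoly _ a.+2]hpolySr [hpoly a.+1 _]hpolySr !succnK IHa' IHk.
rewrite [_ ^+ k.+1]exprS -!mul_polyC !rmorph_nat; move: (_ ^+ k) => W; ring.
Qed.

End Gauss.

(** * Normalized averages over an imaginary Gaussian variable *)

Section Moments.
Variable R : realFieldType.

(* For even m, [nu n m] = n (n + 2) ... (n + m - 2) is the m-th moment of the
   norm of a Gaussian vector of R^n. *)
Fixpoint nu (c : R) (m : nat) : R :=
  if m is m'.+2 then nu c m' * (c + m'%:R) else 1.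

(* The moments of an imaginary Gaussian: [tau (2 j)] = (-1)^j (2 j - 1)!! in
   the usual convention, and odd moments vanish. *)
Fixpoint tau (k : nat) : R := if k is k'.+1 then - k'%:R * tau k'.-1 else 1.

Lemma nu_neq0 (c : R) m : 0 < c -> nu c m != 0.
Proof.
move=> c0; elim/ltn_ind: m => -[|[|m]] IH; rewrite ?oner_eq0 //=.
by rewrite mulf_neq0 ?IH // gt_eqF // ltr_wpDr.
Qed.

(** The functional L_A: s is averaged as an imaginary Gaussian, and dividing by [nu n (A + k)] turns
    Gaussian moments of degree A + k into moments on the unit sphere. Each power of s carries one
    more factor of x. *)
Definition radial (n A : nat) (p : {poly R}) : R :=
  \sum_(k < size p) p`_k * (tau k / nu n%:R (A + k)).

Lemma radialE n A N (p : {poly R}) : (size p <= N)%N ->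
  radial n A p = \sum_(k < N) p`_k * (tau k / nu n%:R (A + k)).
Proof.
pose F k := p`_k * (tau k / nu n%:R (A + k)).
move=> pN; rewrite /radial (big_ord_widen _ F pN) big_mkcond.
by apply: eq_bigr => k _; case: ltnP => // sk; rewrite nth_default ?mul0r.
Qed.

Lemma radial_linear n A : linear_for *%R (radial n A).
Proof.
move=> c p q; pose N := maxn (size p) (size q).
have sN : (size (c *: p + q)%R <= N)%N.
  apply: leq_trans (size_polyD _ _) _.
  by rewrite geq_max leq_maxr (leq_trans (size_scale_leq _ _)) ?leq_maxl.
rewrite !(@radialE _ _ N) ?leq_maxl ?leq_maxr // mulr_sumr -big_split.
by apply: eq_bigr => k _; rewrite coefD coefZ mulrDl mulrA.
Qed.

HB.instance Definition _ n A :=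
  GRing.isLinear.Build R {poly R} R *%R (radial n A) (@radial_linear n A).

Lemma radialC n A c : radial n A c%:P = c / nu n%:R A.
Proof.
rewrite (@radialE _ _ 1) ?size_polyC ?leq_b1 // big_ord1 coefC eqxx addn0.
by rewrite mul1r.
Qed.

(** Integration by parts for a variable of variance -1; [A.+2] makes up for the two powers of s that
    are lost. *)
Lemma radialXM n A p : radial n A ('X * p) = - radial n A.+2 p^`().
Proof.
have sXp : (size ('X * p)%R <= (size p).+2)%N.
  by rewrite (leq_trans (size_polyMleq _ _)) // size_polyX.
have sp' : (size p^`() <= size p)%N by rewrite (leq_trans (size_poly _ _)) ?leq_pred.
(* Two terms drop out: the constant coefficient of X p is zero, and so is [tau 1]. *)
rewrite (radialE _ _ sXp) (radialE _ _ sp') big_ord_recl coefXM mul0r add0r.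
rewrite big_ord_recl /= /bump /= coefXM /= oppr0 !mul0r mulr0 add0r -sumrN.
apply: eq_bigr => k _; rewrite /bump /= !add1n coefXM /= coef_deriv !addnS /=.
by rewrite -mulr_natr; ring.
Qed.

Lemma radialXn n A k : radial n A 'X^k = tau k / nu n%:R (A + k).
Proof.
rewrite (@radialE _ _ k.+1) ?size_polyXn // big_ord_recr /= coefXn eqxx mul1r.
rewrite big1 ?add0r // => i _.
by rewrite coefXn (ltn_eqF (ltn_ord i)) mul0r.
Qed.

(** On X^k the two terms combine to the factor (n + A + k) - (k + 1), where k cancels. *)
Lemma radial_shift n A p : (0 < n)%N ->
  radial n A ((1 + 'X^2) * p) = (n%:R - 1 + A%:R) * radial n A.+2 p.
Proof.
move=> n0; have n0R : (0 : R) < n%:R by rewrite ltr0n.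
rewrite -[p]coefK poly_def mulr_sumr !linear_sum /= mulr_sumr.
apply: eq_bigr => k _; rewrite -scalerAr !linearZ /= mulrDl mul1r -exprD.
rewrite linearD /= !radialXn add2n !addnS !addSn /= natrD.
have := nu_neq0 (A + k) n0R.
have : n%:R + (A%:R + k%:R) != 0 :> R by rewrite gt_eqF // ltr_wpDr // -natrD.
by move=> ? ?; field; apply/andP.
Qed.

(** The factor n - 1 + A is exactly the step from [nu (n - 1) A] to [nu (n - 1) A.+2]. *)
Lemma radial_shiftX n A m p : (0 < n)%N ->
  nu (n%:R - 1) A * radial n A ((1 + 'X^2) ^+ m * p) =
  nu (n%:R - 1) (A + m.*2) * radial n (A + m.*2) p.
Proof.
move=> n0; elim: m A => [|m IH] A; first by rewrite mul1r addn0.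
rewrite exprS -mulrA radial_shift // mulrA doubleS !addnS -!addSn -IH.
by [].
Qed.

End Moments.

(** * Solving the moment recursions *)

Section Recursion.
Variables (R : realFieldType) (n : nat).
Implicit Types (a b : 'I_n -> nat) (i j m : 'I_n).

Definition incr a j : 'I_n -> nat := fun i => (a i + (i == j))%N.
(** Truncated at zero, which is harmless: the recursions weight [decr a j] by [a j]. *)
Definition decr a j : 'I_n -> nat := fun i => (a i - (i == j))%N.
Definition tdeg a : nat := (\sum_i a i)%N.

Lemma tdeg_incr a j : tdeg (incr a j) = (tdeg a).+1.
Proof.
rewrite /tdeg big_split /= (_ : \sum_i (i == j) = 1)%N ?addn1 //.
by rewrite (bigD1 j) //= eqxx big1 // => i /negbTE ->.
Qed.

Lemma decrK a j : (0 < a j)%N -> incr (decr a j) j = a.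
Proof.
move=> aj; apply: funext => i; rewrite /incr /decr; case: eqP => [->|_].
  by rewrite subnK.
by rewrite subn0 addn0.
Qed.

Lemma tdeg_decr a j : (0 < a j)%N -> tdeg a = (tdeg (decr a j)).+1.
Proof. by move=> aj; rewrite -{1}(decrK aj) tdeg_incr. Qed.

Lemma tdeg_eq0 a : tdeg a = 0%N -> a = fun=> 0%N.
Proof.
by move/eqP; rewrite sum_nat_eq0 => /forallP a0; apply: funext => i; apply/eqP/a0.
Qed.

Lemma tdeg_gt0 a : (0 < tdeg a)%N -> exists j, (0 < a j)%N.
Proof.
by rewrite lt0n sum_nat_eq0 negb_forall => /existsP[j aj]; exists j; rewrite lt0n.
Qed.

(** [M a b] stands for E x^a y^b; only [M1] and the two integration-by-parts recursions are kept
    from the Haar measure. *)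
Variable M : ('I_n -> nat) -> ('I_n -> nat) -> R.
Hypothesis n_gt1 : (1 < n)%N.
Hypothesis M1 : M (fun=> 0%N) (fun=> 0%N) = 1.
Hypothesis Mx : forall a j,
  (n%:R - 1 + (tdeg a)%:R) * M (incr a j) (fun=> 0%N) =
  (a j)%:R * M (decr a j) (fun=> 0%N).
Hypothesis My : forall a b j,
  (n%:R - 2 + (tdeg b)%:R) * M a (incr b j) =
  (b j)%:R * M a (decr b j)
  - \sum_m (b m)%:R * M (incr (incr a j) m) (decr b m).

(** A Gaussian vector is its norm times an independent uniform unit vector. The induction lowers one
    exponent by two. *)
Lemma first_row_moment a :
  nu n%:R (tdeg a) * M a (fun=> 0%N) = \prod_i gmom R (a i).
Proof.
have [t] := ubnP (tdeg a); elim: t a => // t IH a.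
have [/tdeg_eq0 ->|] := posnP (tdeg a).
  by rewrite M1 big1 // /tdeg sum_nat_const muln0 mulr1.
case/tdeg_gt0=> j aj; have := Mx (decr a j) j.
rewrite (decrK aj) (tdeg_decr aj) ltnS => Mj ta.
rewrite (bigD1 j) //=.
(* At exponent 1 the right side of [Mx] vanishes while its left factor is positive, so the moment is
   0. *)
have [aj1|aj1] := leqP (a j) 1.
  have aj0 : decr a j j = 0%N by rewrite /decr eqxx; case: (a j) aj1 => [|[]].
  have -> : a j = 1%N by case: (a j) aj aj1 => [|[]].
  rewrite /= !mul0r; move/eqP: Mj; rewrite aj0 mul0r mulf_eq0 => /orP[|/eqP ->].
    rewrite gt_eqF // ltr_wpDr // subr_gt0 ltr1n //.
  by rewrite mulr0.
have [x ajE] : exists x, a j = x.+2 by case: (a j) aj1 => [|[|x]] // _; exists x.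
have djE : decr a j j = x.+1 by rewrite /decr eqxx ajE subn1.
have dj : (0 < decr a j j)%N by rewrite djE.
rewrite (tdeg_decr dj) in Mj ta *.
have := IH (decr (decr a j) j) (leq_trans (leqnSn _) ta).
rewrite (bigD1 j) //= (_ : decr (decr a j) j j = x); last first.
  by rewrite {1}/decr djE eqxx subn1.
rewrite (eq_bigr (fun i => gmom R (a i))); last first.
  by move=> i /negbTE ij; rewrite /decr ij !subn0.
move: Mj; rewrite djE -natr1 ajE /= => Mj IHj.
rewrite -!mulrA -IHj [in RHS]mulrCA -Mj; congr (_ * (_ * _)); ring.
Qed.

(** Induction on |b|, two at a time: [My] for one factor y_j mirrors [hpolyS] in column j, whose
    factor X becomes the subtracted sum through [radialXM] and [deriv_hpoly]. *)
Lemma moment_formula a b : ~~ odd (tdeg b) ->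
  nu (n%:R - 1) (tdeg b) * M a b =
  radial n (tdeg a) (\prod_i hpoly R (b i) (a i)).
Proof.
have n0 : (0 : R) < n%:R by rewrite ltr0n ltnW.
have [t] := ubnP (tdeg b); elim: t a b => // t IH a b.
have [/tdeg_eq0 ->|] := posnP (tdeg b).
  rewrite /= => _ _; rewrite -rmorph_prod radialC /= -first_row_moment.
  rewrite {1}/tdeg sum_nat_const muln0 mul1r [nu _ (tdeg a) * _]mulrC.
  by rewrite mulfK ?nu_neq0.
case/tdeg_gt0=> j bj.
have [c ->] : exists c, b = incr c j by exists (decr b j); rewrite decrK.
rewrite tdeg_incr ltnS oddS negbK => tc oc.
have [s totc] : exists s, tdeg c = s.+1 by case: (tdeg c) oc => [//|s _]; exists s.
have even_s : ~~ odd s by rewrite totc oddS in oc.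
have IHs a' m : (c m)%:R * (nu (n%:R - 1) s * M a' (decr c m)) =
    (c m)%:R * radial n (tdeg a') (\prod_i hpoly R (decr c m i) (a' i)).
  have [->|cm] := posnP (c m); first by rewrite !mul0r.
  have sE : tdeg (decr c m) = s by move: totc; rewrite (tdeg_decr cm) => -[].
  by rewrite -{1}sE IH ?sE // ltnW // -totc.
(* As |c| = s + 1, the factor n - 2 + |c| of [My] is the last factor of [nu (n - 1) s.+2]. *)
have nuE : nu (n%:R - 1) s.+2 * M a (incr c j) =
    nu (n%:R - 1) s * ((n%:R - 2 + (tdeg c)%:R) * M a (incr c j)).
  by rewrite totc -natr1 /=; ring.
rewrite totc nuE My mulrBr mulrCA IHs [X in _ - X]mulr_sumr.
under [X in _ - X]eq_bigr do rewrite mulrCA IHs !tdeg_incr.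
have hpoly_incr : \prod_i hpoly R (incr c j i) (a i) =
    (c j)%:R *: (\prod_i hpoly R (decr c j i) (a i))
    + 'X * \prod_i hpoly R (c i) (incr a j i).
  rewrite !(bigD1 j (P := xpredT)) //= {1}/incr {1}/decr {2}/incr eqxx addn1 addn1.
  rewrite hpolyS subn1 mulrDl scalerAl mulrA; congr (_ * _ + _ * _).
  - by apply: eq_bigr => i /negbTE ij; rewrite /incr /decr ij addn0 subn0.
  - by apply: eq_bigr => i /negbTE ij; rewrite /incr ij !addn0.
rewrite hpoly_incr linearD /= linearZ radialXM; congr (_ - _).
rewrite deriv_prod linear_sum /=; apply: eq_bigr => m _.
rewrite deriv_hpoly -scalerAl linearZ /=; congr (_ * radial _ _ _).
rewrite [LHS](bigD1 m) //= {1}/decr {1}/incr eqxx subn1 addn1; congr (_ * _).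
by apply: eq_bigr => i /negbTE im; rewrite /decr {1}/incr im subn0 addn0.
Qed.

End Recursion.

(** * Expectation over the Haar measure *)

Section Haar.
Local Open Scope classical_set_scope.
Variables (R : realType) (n : nat) (mu : probability (MatSpace R n) R).

Definition orthogonal_set : set (MatSpace R n) := [set u | orthogonal_mx u].

Local Notation O := orthogonal_set.

Lemma measurable_entry (i j : 'I_n) :
  measurable_fun setT (fun u : MatSpace R n => (u : 'M[R]_n) i j).
Proof.
apply: (measurability _ (RGenOpens.measurableE R)).
move=> _ [_ [a [b ->]] <-]; rewrite setTI; apply: sub_sigma_algebra.
have /continuousP := @coord_continuous R n n i j.
by apply; exact: interval_open.
Qed.

Lemma continuous_mulmxl (U : 'M[R]_n) : continuous (fun u : 'M[R]_n => U *m u).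
Proof.
move=> u A [P nP PA]; have FF : Filter (nbhs u) := nbhs_filter u.
have : nbhs u [set v | forall ij : 'I_n * 'I_n, P ij.1 ij.2 ((U *m v) ij.1 ij.2)].
  pose Q (ij : 'I_n * 'I_n) v := P ij.1 ij.2 ((U *m v) ij.1 ij.2).
  apply: (@filter_forall _ _ Q _ FF) => -[i j] /=.
  have : (fun v : 'M[R]_n => (U *m v) i j) @ u --> (U *m u) i j.
    under eq_fun do rewrite mxE; rewrite mxE.
    apply: cvg_big => [|k _]; first exact: add_continuous.
    by apply: cvgMl_tmp; exact: coord_continuous.
  by apply; exact: nP.
by apply: filterS => v Pv; apply: PA => i j; exact: (Pv (i, j)).
Qed.

Lemma measurable_mulmxl (U : 'M[R]_n) :
  measurable_fun setT ((mulmx U : 'M[R]_n -> 'M[R]_n) : MatSpace R n -> MatSpace R n).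
Proof.
apply: (@measurability _ _ _ (MatSpace R n) _ _ (@open 'M[R]_n)) => //.
move=> _ [A oA <-]; rewrite setTI; apply: sub_sigma_algebra.
by have /continuousP := @continuous_mulmxl U; apply.
Qed.

Lemma measurable_orthogonal : measurable O.
Proof.
pose gram i j (u : MatSpace R n) :=
  \sum_k (u : 'M[R]_n) i k * (u : 'M[R]_n) j k.
rewrite (_ : O = \bigcap_(ij in [set: 'I_n * 'I_n])
   [set u | gram ij.1 ij.2 u = (ij.1 == ij.2)%:R]).
  apply: fin_bigcap_measurable; first exact: finite_finset.
  move=> [i j] _ /=.
  rewrite (_ : [set _ | _] = gram i j @^-1` [set (i == j)%:R]) //.
  rewrite -[X in measurable X]setTI.
  have : measurable_fun setT (gram i j).
    by apply: measurable_sum => k; apply: measurable_funM; exact: measurable_entry.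
  by apply.
apply/seteqP; split=> u /=.
  move=> /matrixP uu [i j] _ /=; have := uu i j; rewrite !mxE => <-.
  by apply: eq_bigr => k _; rewrite mxE.
move=> uu; apply/matrixP => i j; rewrite !mxE -(uu (i, j) I).
by apply: eq_bigr => k _; rewrite mxE.
Qed.

(** * Bounded measurable functions and their means *)

(** An algebra of integrable functions; the bound is asked on [O] only, as entries are unbounded
    elsewhere. *)
Definition tame (f : 'M[R]_n -> R) :=
  measurable_fun setT (f : MatSpace R n -> R) /\
  exists K, forall u, orthogonal_mx u -> `|f u| <= K.

Lemma tame_cst c : tame (fun=> c).
Proof. by split; [exact: measurable_cst|exists `|c|]. Qed.

Lemma tameD f g : tame f -> tame g -> tame (fun u => f u + g u).
Proof.
move=> [mf [K fK]] [mg [L gL]]; split; first exact: measurable_funD.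
exists (K + L) => u Ou; rewrite (le_trans (ler_normD _ _)) // lerD ?fK ?gL //.
Qed.

Lemma tameM f g : tame f -> tame g -> tame (fun u => f u * g u).
Proof.
move=> [mf [K fK]] [mg [L gL]]; split; first exact: measurable_funM.
by exists (K * L) => u Ou; rewrite normrM ler_pM ?fK ?gL.
Qed.

Lemma tame_sum I (s : seq I) (P : pred I) (F : I -> 'M[R]_n -> R) :
  (forall i, tame (F i)) -> tame (fun u => \sum_(i <- s | P i) F i u).
Proof.
move=> tF; elim: s => [|i s IH].
  by under eq_fun do rewrite big_nil; exact: tame_cst.
under eq_fun do rewrite big_cons; case: (P i) => //.
exact: (tameD (tF i) IH).
Qed.

Lemma tameX f k : tame f -> tame (fun u => f u ^+ k).
Proof.
move=> tf; elim: k => [|k IH]; first exact: tame_cst.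
by under eq_fun do rewrite exprS; exact: (tameM tf IH).
Qed.

Lemma tame_prod I (s : seq I) (P : pred I) (F : I -> 'M[R]_n -> R) :
  (forall i, tame (F i)) -> tame (fun u => \prod_(i <- s | P i) F i u).
Proof.
move=> tF; elim: s => [|i s IH].
  by under eq_fun do rewrite big_nil; exact: tame_cst.
under eq_fun do rewrite big_cons; case: (P i) => //.
exact: (tameM (tF i) IH).
Qed.

Lemma tame_entry (i j : 'I_n) : tame (fun u => u i j).
Proof.
split; first exact: measurable_entry.
exists 1 => u /matrixP /(_ i i); rewrite !mxE eqxx (bigD1 j) //= mxE => u1.
have : `|u i j| ^+ 2 <= 1 ^+ 2.
  rewrite real_normK ?num_real // expr1n -[1]/(true%:R : R) -u1 -expr2.
  by rewrite lerDl sumr_ge0 // => k _; rewrite mxE -expr2 sqr_ge0.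
by rewrite ler_pXn2r ?nnegrE.
Qed.

(** Integrating over [O] lets orthogonality be used pointwise; [integral_meanE] recovers the full
    integral, the complement being null. *)
Definition haar_mean (f : 'M[R]_n -> R) : R :=
  \int[mu]_(u in O) ((f : MatSpace R n -> R) u).

Local Notation E := haar_mean.

Hypothesis haar_mu : is_Haar_On mu.

Lemma tame_integrable f : tame f ->
  mu.-integrable O (EFin \o (f : MatSpace R n -> R)).
Proof.
move=> [mf [K fK]]; apply: measurable_bounded_integrable.
- exact: measurable_orthogonal.
- rewrite (@le_lt_trans _ _ 1%E) ?probability_le1 ?ltry //.
  exact: measurable_orthogonal.
- exact: measurable_funTS.
- exists K; split; rewrite ?num_real // => x Kx u Ou.
  by apply: le_trans (ltW Kx); exact: fK.
Qed.

Lemma eq_mean f g : (forall u, orthogonal_mx u -> f u = g u) -> E f = E g.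
Proof. by move=> fg; apply: eq_Rintegral => u /set_mem; exact: fg. Qed.

Lemma meanD f g : tame f -> tame g -> E (fun u => f u + g u) = E f + E g.
Proof.
by move=> *; apply: RintegralD; [exact: measurable_orthogonal|exact: tame_integrable..].
Qed.

Lemma meanZ c f : tame f -> E (fun u => c * f u) = c * E f.
Proof.
by move=> *; apply: RintegralZl; [exact: measurable_orthogonal|exact: tame_integrable].
Qed.

Lemma mean_cst c : E (fun=> c) = c.
Proof.
rewrite /E Rintegral_cst; last exact: measurable_orthogonal.
have [muO _] := haar_mu.
by rewrite -[RHS]mulr1; congr (_ * _); exact: (congr1 fine muO).
Qed.

Lemma mean_sum I (s : seq I) (P : pred I) (F : I -> 'M[R]_n -> R) :
  (forall i, tame (F i)) ->
  E (fun u => \sum_(i <- s | P i) F i u) = \sum_(i <- s | P i) E (F i).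
Proof.
move=> tF; elim: s => [|i s IH].
  by under eq_fun do rewrite big_nil; rewrite big_nil mean_cst.
rewrite big_cons -IH; under eq_fun do rewrite big_cons; case: (P i) => //.
by apply: meanD => //; exact: tame_sum.
Qed.

(** Change of variables: the preimage of [O] under multiplication by U is [O], and the pushforward
    of [mu] is [mu]. *)
Lemma mean_mulmxl (U : 'M[R]_n) f : orthogonal_mx U -> tame f ->
  E (fun u => f (U *m u)) = E f.
Proof.
move=> OU tf; have [_ inv] := haar_mu.
pose phi : MatSpace R n -> MatSpace R n := fun u => U *m u.
have phiO : phi @^-1` O = O.
  apply/seteqP; split=> u; rewrite /O /phi /= /orthogonal_mx trmx_mul.
    move=> Uu; have := mulmx1C OU => UTU.
    have : U^T *m (U *m u *m (u^T *m U^T)) *m U = 1%:M by rewrite Uu mulmx1.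
    by rewrite !mulmxA UTU mul1mx -!mulmxA UTU mulmx1.
  by move=> uu; rewrite mulmxA -[U *m u *m _]mulmxA uu mulmx1.
have mphi : measurable_fun setT phi := measurable_mulmxl U.
have tfphi : tame (fun u => f (U *m u)).
  case: tf => mf [K fK]; split; first exact: (measurableT_comp mf mphi).
  by exists K => u Ou; apply: fK; move: Ou; rewrite -[orthogonal_mx u]/(O u) -phiO.
have := @integral_pushforward _ _ _ _ R phi mphi mu O (EFin \o f).
rewrite phiO => pushE; rewrite /E /Rintegral; congr fine.
rewrite -[LHS]pushE.
- by apply: eq_measure_integral => A mA _; exact: (inv U OU A mA).
- by apply/measurable_EFinP; case: tf.
- exact: tame_integrable tfphi.
- exact: measurable_orthogonal.
Qed.

Lemma integral_meanE f : tame f ->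
  \int[mu]_u ((f : MatSpace R n -> R) u) = E f.
Proof.
move=> tf; rewrite /E [RHS]Rintegral_mkcond /Rintegral; congr fine.
have mO := measurable_orthogonal.
have muO0 : mu (~` O) = 0%E.
  by have [muO _] := haar_mu; rewrite probability_setC // muO subee.
have [mf _] := tf.
apply: ae_eq_integral => //.
- exact/measurable_EFinP.
- by apply/measurable_EFinP; apply/(measurable_restrictT _ mO); exact: measurable_funTS.
- exists (~` O); split; first exact: measurableC.
    exact: muO0.
  move=> u /= /not_implyP[_ fu] Ou; apply: fu.
  by rewrite patchE mem_set.
Qed.

End Haar.

(** * Integration by parts from row reflections *)

(** Otherwise the first [size p] naturals would be too many distinct roots. *)
Lemma poly_vanish_eq0 (R : numDomainType) (p : {poly R}) :
  (forall t, p.[t] = 0) -> p = 0.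
Proof.
move=> p0; apply/eqP/negP => /negP pn0.
have := @max_poly_roots _ p [seq (i%:R : R) | i <- iota 0 (size p)] pn0.
rewrite size_map size_iota ltnn => H; suff: false by []; apply: H.
  by apply/allP => x _; rewrite /root p0.
by rewrite map_inj_uniq ?iota_uniq // => x y /eqP; rewrite eqr_nat => /eqP.
Qed.

Section RowReflection.
Variables (R : realType) (n : nat) (mu : probability (MatSpace R n) R).
Hypothesis haar_mu : is_Haar_On mu.
Local Notation E := (haar_mean mu).

Definition row_monomial (u : 'M[R]_n) (i : 'I_n) (b : 'I_n -> nat) : R :=
  \prod_m u i m ^+ b m.

Lemma tame_row_monomial i b : tame (fun u => row_monomial u i b).
Proof. by apply: tame_prod => m; apply: tameX; exact: tame_entry. Qed.

Lemma row_monomial0 u i : row_monomial u i (fun=> 0%N) = 1.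
Proof. by rewrite /row_monomial big1. Qed.

Lemma row_monomial_incr u i b j :
  row_monomial u i (incr b j) = u i j * row_monomial u i b.
Proof.
rewrite /row_monomial !(bigD1 j (P := xpredT)) //= {1}/incr eqxx addn1 exprS mulrA.
by congr (_ * _); apply: eq_bigr => m /negbTE mj; rewrite /incr mj addn0.
Qed.

(** A reflection and not a rotation: at c = 1, s = 0 it just negates row l. *)
Definition reflection (k l : 'I_n) (c s : R) : 'M[R]_n :=
  \matrix_(i, m) if i == k then c * (k == m)%:R + s * (l == m)%:R
    else if i == l then s * (k == m)%:R - c * (l == m)%:R else (i == m)%:R.

Lemma reflectionE k l c s (u : 'M[R]_n) i j :
  (reflection k l c s *m u) i j =
  if i == k then c * u k j + s * u l j
  else if i == l then s * u k j - c * u l j else u i j.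
Proof.
have pick (i' : 'I_n) : \sum_m (i' == m)%:R * u m j = u i' j.
  rewrite (bigD1 i') //= eqxx mul1r big1 ?addr0 // => m.
  by rewrite eq_sym => /negbTE ->; rewrite mul0r.
rewrite mxE; under eq_bigr do rewrite mxE.
case: eqP => _; [|case: eqP => _]; rewrite -?pick //.
  by rewrite !mulr_sumr -big_split; apply: eq_bigr => m _; rewrite mulrDl !mulrA.
rewrite !mulr_sumr -sumrB; apply: eq_bigr => m _.
by rewrite mulrBl !mulrA.
Qed.

Lemma orthogonal_reflection k l c s : k != l -> c ^+ 2 + s ^+ 2 = 1 ->
  orthogonal_mx (reflection k l c s).
Proof.
move=> kl cs; apply/matrixP => i j; rewrite reflectionE !mxE.
have lk : (l == k) = false by rewrite eq_sym (negbTE kl).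
have [ik|ik] := eqVneq i k; last have [il|il] := eqVneq i l.
all: have [jk|jk] := eqVneq j k; last have [jl|jl] := eqVneq j l.
all: rewrite ?ik ?il ?jk ?jl ?eqxx ?(negbTE kl) ?lk.
all: rewrite ?(negbTE jk) ?(negbTE jl) ?[_ == j]eq_sym ?(negbTE jk) ?(negbTE jl).
all: rewrite ?[k == i]eq_sym ?[l == i]eq_sym ?(negbTE ik) ?(negbTE il) ?mulr0n ?mulr1n.
all: by [ring | rewrite -[RHS]cs; ring].
Qed.

(** * Random polynomials of bounded degree *)

Definition tame_poly (P : 'M[R]_n -> {poly R}) :=
  (forall k, tame (fun u => (P u)`_k)) /\ exists N, forall u, (size (P u) <= N)%N.

Lemma tame_polyM P Q : tame_poly P -> tame_poly Q ->
  tame_poly (fun u => P u * Q u).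
Proof.
move=> [tP [N sP]] [tQ [L sQ]]; split=> [k|].
  by under eq_fun do rewrite coefM; apply: tame_sum => i; exact: tameM.
exists (N + L)%N => u; apply: leq_trans (size_polyMleq _ _) _.
by rewrite (leq_trans (leq_pred _)) // leq_add.
Qed.

Lemma tame_poly_prod I (s : seq I) (P : I -> 'M[R]_n -> {poly R}) :
  (forall i, tame_poly (P i)) -> tame_poly (fun u => \prod_(i <- s) P i u).
Proof.
move=> tP; elim: s => [|i s IH].
  under eq_fun do rewrite big_nil; split=> [k|]; first exact: tame_cst.
  by exists 1%N => u; rewrite size_poly1.
by under eq_fun do rewrite big_cons; exact: tame_polyM.
Qed.

Lemma tame_polyX P k : tame_poly P -> tame_poly (fun u => P u ^+ k).
Proof.
move=> tP; elim: k => [|k IH]; last first.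
  by under eq_fun do rewrite exprS; exact: tame_polyM.
under eq_fun do rewrite expr0; split=> [k|]; first exact: tame_cst.
by exists 1%N => u; rewrite size_poly1.
Qed.

Lemma tame_poly_affine f g : tame f -> tame g ->
  tame_poly (fun u => (f u)%:P + g u *: 'X).
Proof.
move=> tf tg; split=> [k|].
  under eq_fun do rewrite coefD coefC coefZ coefX.
  apply: tameD; first by case: (k == 0%N) => //; exact: tame_cst.
  by apply: tameM => //; exact: tame_cst.
exists 2 => u; rewrite (leq_trans (size_polyD _ _)) // geq_max.
rewrite (leq_trans (size_polyC_leq1 _)) //=.
by rewrite (leq_trans (size_scale_leq _ _)) // size_polyX.
Qed.

Lemma tame_horner P t : tame_poly P -> tame (fun u => (P u).[t]).
Proof.
move=> [tP [N sP]]; under eq_fun do rewrite (horner_coef_wide _ (sP _)).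
by apply: tame_sum => i; apply: tameM => //; exact: tame_cst.
Qed.

(** By the uniform degree bound, the mean of P(t) is a polynomial in t with the mean coefficients;
    it vanishes everywhere. *)
Lemma mean_horner_eq0 P : tame_poly P ->
  (forall t, E (fun u => (P u).[t]) = 0) -> forall k, E (fun u => (P u)`_k) = 0.
Proof.
move=> [tP [N sP]] P0 k; pose q := \poly_(i < N) E (fun u => (P u)`_i).
have q0 : q = 0.
  apply: poly_vanish_eq0 => t; rewrite horner_poly -[RHS](P0 t).
  transitivity (E (fun u => \sum_(i < N) t ^+ i * (P u)`_i)).
    rewrite (mean_sum haar_mu); last by move=> i; apply: tameM => //; exact: tame_cst.
    by apply: eq_bigr => i _; rewrite meanZ // mulrC.
  apply: eq_mean => u _; rewrite (horner_coef_wide _ (sP u)).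
  by apply: eq_bigr => i _; rewrite mulrC.
have [kN|Nk] := ltnP k N; first by move/polyP: q0 => /(_ k); rewrite coef_poly kN coef0.
rewrite -[RHS](mean_cst haar_mu 0); apply: eq_mean => u _.
by rewrite nth_default // (leq_trans (sP u)).
Qed.

(* Reflecting in the plane of rows k and l with angle arctan t turns
   [E (u_lj y^b g) = 0] into the vanishing of a polynomial in t, whose
   coefficient of degree 1 is the claim; no derivative of an integral is taken. *)
Lemma row_transfer (k l : 'I_n) (g : 'M[R]_n -> R) (b : 'I_n -> nat)
    (j : 'I_n) : k != l -> tame g ->
  (forall u v : 'M[R]_n, (forall i m, i != k -> i != l -> u i m = v i m) -> g u = g v) ->
  E (fun u => u k j * row_monomial u k b * g u) =
  \sum_m (b m)%:R *
    E (fun u => u l j * u l m * row_monomial u k (decr b m) * g u).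
Proof.
move=> kl tg gkl.
have lk : (l == k) = false by rewrite eq_sym (negbTE kl).
pose F (u : 'M[R]_n) := u l j * row_monomial u k b * g u.
(* F after the reflection with s = c t, divided by c^(|b| + 1): F is homogeneous of that degree in
   rows k and l, and g ignores both. *)
pose P (u : 'M[R]_n) : {poly R} := ((- g u * u l j)%:P + (g u * u k j) *: 'X) *
  \prod_m ((u k m)%:P + u l m *: 'X) ^+ b m.
have tu i m : tame (fun u : 'M[R]_n => u i m) by exact: tame_entry.
have tN f : tame f -> tame (fun u => - f u).
  move=> tf; under eq_fun do rewrite -mulN1r.
  by apply: tameM => //; exact: tame_cst.
have tF : tame F by do 2?apply: tameM => //; exact: tame_row_monomial.
have tP : tame_poly P.
  apply: tame_polyM; last first.
    by apply: tame_poly_prod => m; apply: tame_polyX; exact: tame_poly_affine.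
  by apply: tame_poly_affine; apply: tameM => //; exact: tN.
have P_horner u t : (P u).[t] =
    (t * u k j - u l j) * (\prod_m (u k m + t * u l m) ^+ b m) * g u.
  rewrite /P hornerM horner_prod !hornerE.
  under eq_bigr do rewrite !hornerE mulrC.
  by move: (\prod_m _) => Q; ring.
have reflF c t u : c ^+ 2 + (c * t) ^+ 2 = 1 ->
    F (reflection k l c (c * t) *m u) = c ^+ (tdeg b).+1 * (P u).[t].
  move=> ct; rewrite /F /row_monomial P_horner reflectionE lk eqxx.
  under eq_bigr do rewrite reflectionE eqxx -mulrA -mulrDr exprMn.
  rewrite big_split /= prodrXr -/(tdeg b) (gkl _ u); last first.
    by move=> i m /negbTE ik /negbTE il; rewrite reflectionE ik il.
  by rewrite exprS; move: (\prod_m _) (c ^+ _) => Q C; ring.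
have EF c t : c ^+ 2 + (c * t) ^+ 2 = 1 ->
    E F = c ^+ (tdeg b).+1 * E (fun u => (P u).[t]).
  move=> ct; rewrite -(mean_mulmxl haar_mu (orthogonal_reflection kl ct) tF).
  rewrite -meanZ; last exact: tame_horner.
  by apply: eq_mean => u _; exact: reflF.
(* At t = 0 the reflection negates row l, in which F is odd. *)
have EF0 : E F = 0.
  apply/eqP; rewrite -eqNr eq_sym {1}(EF 1 0); last first.
    by rewrite mulr0 expr1n expr0n addr0.
  rewrite expr1n mul1r -mulN1r -meanZ //; apply/eqP/eq_mean => u _.
  rewrite P_horner mul0r sub0r /F /row_monomial.
  under eq_bigr do rewrite mul0r addr0.
  by move: (\prod_m _) => Q; ring.
have EP0 t : E (fun u => (P u).[t]) = 0.
  have t1 : 0 < 1 + t ^+ 2 by rewrite ltr_pwDl // sqr_ge0.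
  pose c := (Num.sqrt (1 + t ^+ 2))^-1.
  have c0 : c != 0 by rewrite invr_eq0 gt_eqF // sqrtr_gt0.
  have : c ^+ 2 + (c * t) ^+ 2 = 1.
    rewrite exprMn -[X in X + _]mulr1 -mulrDr exprVn sqr_sqrtr ?ltW //.
    by rewrite mulVf // gt_eqF.
  move/EF; rewrite EF0 => /esym/eqP; rewrite mulf_eq0 expf_eq0 (negbTE c0) andbF.
  by move/eqP.
have P1 u : (P u)`_1 = u k j * row_monomial u k b * g u
    - \sum_m (b m)%:R * (u l j * u l m * row_monomial u k (decr b m) * g u).
  rewrite -[(P u)`_1]mulr1n -coef_deriv -horner_coef0 derivM !derivD !derivC.
  rewrite !derivZ derivX deriv_prod !hornerE horner_prod horner_sum.
  under eq_bigr do rewrite !hornerE.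
  under [X in _ + _ * X]eq_bigr => m _.
    rewrite deriv_exp derivD derivC derivZ derivX !hornerE hornerMn horner_prod !hornerE.
    under eq_bigr do rewrite !hornerE.
    over.
  rewrite /row_monomial.
  congr (_ + _); first by move: (\prod_i _) => Q; ring.
  rewrite !mulNr mulr_sumr; congr (- _); apply: eq_bigr => m _.
  rewrite [in RHS](bigD1 m) //= {1}/decr eqxx subn1.
  rewrite [in RHS](eq_bigr (fun i => u k i ^+ b i)); last first.
    by move=> i /negbTE im; rewrite /decr im subn0.
  by rewrite -mulr_natl; move: (\prod_(_ | _) _) => Q; ring.
pose S (u : 'M[R]_n) :=
  \sum_m (b m)%:R * (u l j * u l m * row_monomial u k (decr b m) * g u).
have tS m : tame (fun u : 'M[R]_n =>
    u l j * u l m * row_monomial u k (decr b m) * g u).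
  by do 2?apply: tameM => //; [exact: tameM|exact: tame_row_monomial].
have tbS m := tameM (@tame_cst R n (b m)%:R) (tS m).
transitivity (E (fun u => (P u)`_1 + S u)).
  by apply: eq_mean => u _; rewrite P1 subrK.
rewrite meanD ?(mean_horner_eq0 tP EP0) ?add0r; last 2 first.
- by case: tP.
- exact: tame_sum.
by rewrite (mean_sum haar_mu) //; apply: eq_bigr => m _; rewrite meanZ.
Qed.

Lemma orthogonal_col (u : 'M[R]_n) j m : orthogonal_mx u ->
  \sum_l u l j * u l m = (j == m)%:R.
Proof.
move=> /mulmx1C /matrixP /(_ j m); rewrite !mxE => <-.
by apply: eq_bigr => l _; rewrite mxE.
Qed.

(** Let X_l be the right side of [row_transfer]. Column orthonormality evaluates the sum of X_l over
    all rows; each of the n - |A| rows outside A contributes the left mean, and l = k contributes it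
    |b| times. *)
Lemma row_ibp (A : {set 'I_n}) (k : 'I_n) (g : 'M[R]_n -> R)
    (b : 'I_n -> nat) (j : 'I_n) : k \in A -> tame g ->
  (forall u v : 'M[R]_n,
     (forall i m, i \in A -> i != k -> u i m = v i m) -> g u = g v) ->
  (n%:R - #|A|%:R + (tdeg b)%:R) *
    E (fun u => u k j * row_monomial u k b * g u) =
  (b j)%:R * E (fun u => row_monomial u k (decr b j) * g u)
  - \sum_(l in A | l != k) \sum_m (b m)%:R *
      E (fun u => u l j * u l m * row_monomial u k (decr b m) * g u).
Proof.
move=> kA tg gA; have tu i m : tame (fun u : 'M[R]_n => u i m) by exact: tame_entry.
set Ek := E (fun u => u k j * row_monomial u k b * g u).
pose X l := \sum_m (b m)%:R *
  E (fun u => u l j * u l m * row_monomial u k (decr b m) * g u).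
have Xout l : l \notin A -> X l = Ek.
  move=> lA; have kl : k != l by apply: contraNneq lA => <-.
  apply/esym/row_transfer => // u v uv; apply: gA => i m iA ik; apply: uv => //.
  by apply: contraNneq lA => <-.
have Xk : X k = (tdeg b)%:R * Ek.
  rewrite /tdeg natr_sum mulr_suml; apply: eq_bigr => m _.
  have [->|bm] := posnP (b m); first by rewrite !mul0r.
  congr (_ * _); apply: eq_mean => u _.
  by rewrite -{2}(decrK bm) row_monomial_incr !mulrA.
have Xall : \sum_l X l = (b j)%:R * E (fun u => row_monomial u k (decr b j) * g u).
  have mean_col m : \sum_l E (fun u => u l j * u l m * row_monomial u k (decr b m) * g u)
      = (j == m)%:R * E (fun u => row_monomial u k (decr b m) * g u).
    rewrite -(mean_sum haar_mu); last first.
      by move=> l; do 2?apply: tameM => //; [exact: tameM|exact: tame_row_monomial].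
    rewrite -meanZ; last by apply: tameM => //; exact: tame_row_monomial.
    by apply: eq_mean => u Ou; rewrite -!mulr_suml (orthogonal_col _ _ Ou) mulrA.
  rewrite exchange_big (bigD1 j) //= -mulr_sumr mean_col eqxx mul1r.
  rewrite big1 ?addr0 // => m; rewrite eq_sym => /negbTE jm.
  by rewrite -mulr_sumr mean_col jm mul0r mulr0.
have Xsum : \sum_(l | l \notin A) X l = (n%:R - #|A|%:R) * Ek.
  rewrite (eq_bigr (fun=> Ek)) // sumr_const -[LHS]mulr_natl; congr (_ * _).
  have : (#|A| + #|[predC A]|)%:R = n%:R :> R by rewrite cardC card_ord.
  by rewrite natrD => <-; rewrite addrAC subrr add0r.
rewrite -Xall (bigID [in A]) /= (bigD1 k) //= Xk Xsum -/(X _).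
by rewrite mulrDl; ring.
Qed.

(** * Recursions for the joint moments of two rows *)

Variables (i0 i1 : 'I_n).
Hypothesis i01 : i0 != i1.

Definition moment (a b : 'I_n -> nat) : R :=
  E (fun u => row_monomial u i1 b * row_monomial u i0 a).

Lemma moment0 : moment (fun=> 0%N) (fun=> 0%N) = 1.
Proof.
rewrite /moment -[RHS](mean_cst haar_mu); apply: eq_mean => u _.
by rewrite !row_monomial0 mulr1.
Qed.

Lemma moment_row0 (a : 'I_n -> nat) j :
  (n%:R - 1 + (tdeg a)%:R) * moment (incr a j) (fun=> 0%N) =
  (a j)%:R * moment (decr a j) (fun=> 0%N).
Proof.
have := @row_ibp [set i0] i0 (fun=> 1) a j (set11 _) (@tame_cst R n 1)
  (fun _ _ _ => erefl).
rewrite cards1 big_pred0 ?subr0 => [ibp|l]; last by rewrite inE andbN.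
have -> : moment (incr a j) (fun=> 0%N) =
    E (fun u => u i0 j * row_monomial u i0 a * 1).
  by apply: eq_mean => u _; rewrite row_monomial0 row_monomial_incr mul1r mulr1.
rewrite ibp; congr (_ * _).
by apply: eq_mean => u _; rewrite row_monomial0 mul1r mulr1.
Qed.

(** With A = {i0, i1} and g = x^a, only l = i0 remains in the sum, and its two entries raise a. *)
Lemma moment_row1 (a b : 'I_n -> nat) j :
  (n%:R - 2 + (tdeg b)%:R) * moment a (incr b j) =
  (b j)%:R * moment a (decr b j)
  - \sum_m (b m)%:R * moment (incr (incr a j) m) (decr b m).
Proof.
have := @row_ibp [set i0; i1] i1 (fun u => row_monomial u i0 a) b j (set22 _ _)
  (tame_row_monomial _ _).
rewrite cards2 i01 (big_pred1 i0) => [|l]; last first.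
  by rewrite !inE; case: (eqVneq l i0) => [->|_] //=; rewrite andbN.
move=> ibp; have -> : moment a (incr b j) =
    E (fun u => u i1 j * row_monomial u i1 b * row_monomial u i0 a).
  by apply: eq_mean => u _; rewrite row_monomial_incr.
rewrite ibp => [|u v uv]; last first.
  by apply: eq_bigr => m _; rewrite uv // !inE eqxx.
congr (_ - _); apply: eq_bigr => m _; congr (_ * _); apply: eq_mean => u _.
by rewrite !row_monomial_incr; ring.
Qed.

End RowReflection.

(** * The column swap *)

Section ColumnSwap.
Variable R : realFieldType.

Lemma hpoly_swap_even x y : ~~ odd x -> ~~ odd y ->
  (1 + 'X^2) ^+ x./2 * hpoly R y x = (1 + 'X^2) ^+ y./2 * hpoly R x y.
Proof.
wlog xy : x y / (x <= y)%N.
  by move=> H ex ey; have [|/ltnW] := leqP x y => /H -> //.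
move=> ex ey; have yE : y = (x + (y./2 - x./2).*2)%N.
  by rewrite doubleB !even_halfK // subnKC.
have hy : y./2 = (x./2 + (y./2 - x./2))%N by rewrite subnKC ?half_leq.
by rewrite {1}yE hpoly_swap -yE mulrA -exprD -hy.
Qed.

Lemma one_plus_X2_neq0 : 1 + 'X^2 != 0 :> {poly R}.
Proof. by rewrite addrC -size_poly_gt0 size_XnaddC. Qed.

(** Swapping columns multiplies the product of the [hpoly] by a power of 1 + X^2, and
    [radial_shiftX] absorbs it as the change of |a|. *)
Lemma radial_swap n (a b a' b' : 'I_n -> nat) : (0 < n)%N ->
  (forall i, ~~ odd (a i)) -> (forall i, ~~ odd (b i)) ->
  (forall i, (a' i, b' i) = (a i, b i) \/ (a' i, b' i) = (b i, a i)) ->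
  nu (n%:R - 1) (tdeg a) * radial n (tdeg a) (\prod_i hpoly R (b i) (a i)) =
  nu (n%:R - 1) (tdeg a') * radial n (tdeg a') (\prod_i hpoly R (b' i) (a' i)).
Proof.
move=> n0; pose hdeg (f : 'I_n -> nat) := (\sum_i (f i)./2)%N.
wlog le_aa' : a b a' b' / (hdeg a <= hdeg a')%N.
  move=> H ea eb ab; have [le|/ltnW le] := leqP (hdeg a) (hdeg a'); first exact: H.
  apply/esym/H => // i; case: (ab i) => -[aE bE]; rewrite ?aE ?bE ?ea ?eb //.
    by left.
  by right.
move=> ea eb ab.
have ea' i : ~~ odd (a' i) by case: (ab i) => -[-> _].
have tdegE f : (forall i, ~~ odd (f i)) -> tdeg f = (hdeg f).*2.
  move=> ef; rewrite /hdeg -muln2 big_distrl; apply: eq_bigr => i _ /=.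
  by rewrite muln2 even_halfK.
have swapP : (1 + 'X^2) ^+ hdeg a * \prod_i hpoly R (b i) (a i) =
    (1 + 'X^2) ^+ hdeg a' * \prod_i hpoly R (b' i) (a' i).
  rewrite -!prodrXr -!big_split; apply: eq_bigr => i _ /=.
  by case: (ab i) => -[-> ->] //; exact: hpoly_swap_even.
have -> : \prod_i hpoly R (b i) (a i) =
    (1 + 'X^2) ^+ (hdeg a' - hdeg a) * \prod_i hpoly R (b' i) (a' i).
  (* The common power is cancelled in the integral domain of polynomials. *)
  apply: (mulfI (expf_neq0 (hdeg a) one_plus_X2_neq0)).
  by rewrite swapP mulrA -exprD subnKC.
rewrite radial_shiftX // (tdegE a) // (tdegE a') //.
by rewrite -doubleD subnKC.
Qed.

(** In this convention (m + 2)!! = (m + 1) m!!, so the factors gained from n - 2 on are n - 1, n +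
    1, and so on. *)
Lemma dfact_nu n A : (1 < n)%N -> ~~ odd A ->
  (dfact (A + n - 2))%:R = (dfact (n - 2))%:R * nu (n%:R - 1) A :> R.
Proof.
case: n => [|[|n]] // _; rewrite -addnBA // !subn2 /=.
elim/ltn_ind: A => -[|[|A]] IH //; first by rewrite mulr1.
rewrite /= negbK => eA; have dfactSS m : dfact m.+2 = (m.+1 * dfact m)%N.
  by case: m => [|m].
rewrite -[X in X%:R = _]/(dfact (A + n).+2) dfactSS natrM IH // -!natr1 natrD; ring.
Qed.

End ColumnSwap.

(** * The normalized integral as a radial functional *)

Lemma big_nth_ord (T : Type) (idx : T) (op : Monoid.law idx) (F : nat -> T)
    (s : seq nat) n : F 0%N = idx -> (size s <= n)%N ->
  \big[op/idx]_(x <- s) F x = \big[op/idx]_(i < n) F (nth 0%N s i).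
Proof.
move=> F0 sn; rewrite (big_nth 0%N) big_mkord.
rewrite (big_ord_widen _ (fun i => F (nth 0%N s i)) sn) big_mkcond.
by apply: eq_bigr => i _; case: ltnP => // si; rewrite nth_default.
Qed.

Section PhiFormula.
Variables (R : realType) (n : nat) (mu : probability (MatSpace R n) R).
Hypothesis haar_mu : is_Haar_On mu.

(** Missing columns get exponent 0, so that all n columns are treated alike. *)
Definition exponents (s : seq nat) : 'I_n -> nat := fun i => nth 0%N s i.

Lemma tdeg_exponents s : (size s <= n)%N -> tdeg (exponents s) = sumn s.
Proof. by move=> sn; rewrite sumnE (big_nth_ord _ _ sn). Qed.

Lemma In_int_moment (n1 : (1 < n)%N) a b :
  size a = size b -> (size a <= n)%N ->
  In_int mu a b = moment mu (Ordinal (ltnW n1)) (Ordinal n1) (exponents a) (exponents b).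
Proof.
move=> ab an.
have entE (u : 'M[R]_n) i (i_lt : (i < n)%N) (j : 'I_n) : ent u i j = u (Ordinal i_lt) j.
  by rewrite /ent insubT valK.
rewrite /moment -integral_meanE //; last first.
  by apply: tameM; exact: tame_row_monomial.
congr Rintegral; apply: funext => u.
rewrite (big_ord_widen _ (fun j => ent (u : 'M[R]_n) 0 j ^+ nth 0%N a j
  * ent (u : 'M[R]_n) 1 j ^+ nth 0%N b j) an) big_mkcond.
rewrite mulrC -big_split; apply: eq_bigr => j _ /=.
case: ltnP => sj; first by rewrite (entE _ _ (ltnW n1)) (entE _ _ n1).
by rewrite /exponents !nth_default -?ab // !expr0 mulr1.
Qed.

(** The double factorial of b supplies the [nu] factor of [moment_formula], that of a the one of
    [radial_shiftX]; the (n - 2)!! cancel. *)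
Lemma Phi_radial a b : (1 < n)%N -> size a = size b -> (size a <= n)%N ->
  all (fun x => ~~ odd x) a -> all (fun x => ~~ odd x) b ->
  Phi mu a b = nu (n%:R - 1) (tdeg (exponents a)) *
    radial n (tdeg (exponents a)) (\prod_i hpoly R (exponents b i) (exponents a i))
    / ((\prod_(x <- a) dfact x)%:R * (\prod_(x <- b) dfact x)%:R).
Proof.
move=> n1 ab an ea eb.
have bn : (size b <= n)%N by rewrite -ab.
have even_sumn s : all (fun x => ~~ odd x) s -> ~~ odd (sumn s).
  by elim: s => //= x s IH /andP[ex /IH es]; rewrite oddD (negbTE ex).
have d0 : (dfact (n - 2))%:R != 0 :> R.
  have sd m : (0 < sdfact m)%N.
    by elim/ltn_ind: m => -[|[|m]] // IH; rewrite muln_gt0 /= IH.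
  by rewrite pnatr_eq0 -lt0n; case: (n - 2)%N.
rewrite /Phi (In_int_moment n1) // -!tdeg_exponents // !dfact_nu //; last 2 first.
- by rewrite tdeg_exponents // even_sumn.
- by rewrite tdeg_exponents // even_sumn.
have n01 : Ordinal (ltnW n1) != Ordinal n1 by [].
rewrite -(@moment_formula R n (moment mu (Ordinal (ltnW n1)) (Ordinal n1))) //.
- rewrite !invfM; move: (moment _ _ _ _ _) (\prod_(x <- a) _)%:R^-1.
  move: (\prod_(x <- b) _)%:R^-1 => Db M Da.
  by field.
- exact: moment0.
- exact: moment_row0.
- exact: moment_row1.
- by rewrite tdeg_exponents // even_sumn.
Qed.

End PhiFormula.

Theorem theorem5p3 (R : realType) (p q n : nat) (a b c d : seq nat)
  (ha : size a = p) (hb : size b = p) (hc : size c = q) (hd : size d = q)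
  (hae : all (fun x => ~~ odd x) a) (hbe : all (fun x => ~~ odd x) b)
  (hce : all (fun x => ~~ odd x) c) (hde : all (fun x => ~~ odd x) d)
  (hn : (maxn 2 (p + q) <= n)%N)
  (mu : probability (MatSpace R n) R) (hmu : is_Haar_On mu) :
  Phi mu (a ++ c) (b ++ d) = Phi mu (a ++ d) (b ++ c).
Proof.
move: hn; rewrite geq_max => /andP[n1 pqn].
have even_nth s i : all (fun x => ~~ odd x) s -> ~~ odd (nth 0%N s i).
  move=> es; have [si|si] := ltnP i (size s); last by rewrite nth_default.
  exact: (all_nthP 0%N es).
rewrite !Phi_radial ?size_cat ?ha ?hb ?hc ?hd ?all_cat ?hae ?hbe ?hce ?hde //.
(* The first p columns stay and the others are exchanged; the denominators only have their factors
   permuted. *)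
rewrite (@radial_swap R n _ _ (exponents (a ++ d)) (exponents (b ++ c))) ?(ltnW n1) //.
- by rewrite !big_cat /= !natrM; congr (_ / _); ring.
- by move=> i; apply: even_nth; rewrite all_cat hae.
- by move=> i; apply: even_nth; rewrite all_cat hbe.
- by move=> i; rewrite /exponents !nth_cat ha hb; case: ifP => _; [left|right].
Qed.
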